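(* Let $k$ be a positive integer. There exist a forecasting algorithm $f$ and a method of randomization (in the sense of the context, and not depending on the sequences or the set below) such that for every sequence of real numbers $S_1,S_2,\dots$ with $S_i\in[0,1]$, every sequence of signals $\bar x_1,\bar x_2,\dots\in[0,1]^k$, and every subset $\mathcal S\subseteq[0,1]^{k+1}$ with characteristic function $I$, the following holds. Let $p_i$ be the forecasts computed by $f$, let $\tilde p_i$ be the randomization of $p_i$, and let $\tilde x_i=(\tilde x_{i,1},\dots,\tilde x_{i,k})$ be obtained by independent randomization of each coordinate $x_{i,j}$ of $\bar x_i$. Then the event $$\lim_{n\to\infty}\frac1n\sum_{i=1}^n I(\tilde p_i,\tilde x_i)\,(S_i-\tilde p_i)=0$$ has $Pr$-probability $1$, where $Pr$ is the probability distribution generated by the sequence of tuples of random variables $(\tilde p_i,\tilde x_i)$, $i=1,2,\dots$. Moreover, $\mathrm{Var}_n(\tilde p_n)\to0$ and $\mathrm{Var}_n(\tilde x_{n,j})\to0$ as $n\to\infty$ for all $j=1,\dots,k$.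
   Context: Prediction protocol: at step $n$ the forecaster has observed the past outcomes $S_1,\dots,S_{n-1}\in[0,1]$ and the signals $\bar x_1,\dots,\bar x_n\in[0,1]^k$, where $\bar x_n=(x_{n,1},\dots,x_{n,k})$; he announces a randomized forecast $\tilde p_n$ of $S_n$; then $S_n$ is revealed. A forecasting algorithm $f$ is a deterministic rule which at each step $n$ computes a forecast $p_n\in[0,1]$ from $S_1,\dots,S_{n-1}$ and $\bar x_1,\dots,\bar x_n$. A sequence of random variables $\tilde y_1,\tilde y_2,\dots$ is a randomization of a sequence of real numbers $y_1,y_2,\dots$ if $E_n(\tilde y_n)=y_n$ for all $n$, where $E_n$ denotes mathematical expectation (over the internal randomness used at step $n$). A method of randomization is a rule which, for each step $n$, assigns to every number $y\in[0,1]$ a probability distribution on $[0,1]$ with mean $y$; $\tilde p_n$ and the coordinates $\tilde x_{n,1},\dots,\tilde x_{n,k}$ are drawn from the distributions assigned at step $n$ to $p_n,x_{n,1},\dots,x_{n,k}$, independently of each other and independently across steps. Here $\mathrm{Var}_n(\tilde p_n)=E_n(\tilde p_n-p_n)^2$ and $\mathrm{Var}_n(\tilde x_{n,j})=E_n(\tilde x_{n,j}-x_{n,j})^2$. For $\mathcal S\subseteq[0,1]^{k+1}$, $p\in[0,1]$ and $\bar x\in[0,1]^k$, the characteristic function is $I(p,\bar x)=1$ if $(p,\bar x)\in\mathcal S$ and $I(p,\bar x)=0$ otherwise. *)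

(* Defs.v *)
From HB Require Import structures.
From mathcomp Require Import all_boot all_order all_algebra.
From mathcomp Require Import all_classical all_reals all_analysis.

Set Implicit Arguments.
Unset Strict Implicit.
Unset Printing Implicit Defensive.

Import Order.TTheory GRing.Theory Num.Theory.
Import numFieldNormedType.Exports.

Local Open Scope classical_set_scope.
Local Open Scope ring_scope.

(* Steps are numbered from 0: the step written [n] here is step n+1 of the
   prediction protocol, at which n past outcomes and n+1 signals are known. *)

Definition unit_cube (R : realType) (k : nat) : set 'rV[R]_k :=
  [set x | forall j, x ord0 j \in `[0, 1]%R].

(* [forecast n s x] is only meaningful for outcomes in [0,1] and signals in
   [0,1]^k; nothing is required of its values elsewhere. *)
Record forecasting_algorithm (R : realType) (k : nat) := ForecastingAlgorithm {
  forecast : forall n : nat, n.-tuple R -> n.+1.-tuple 'rV[R]_k -> R ;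
  forecast01 : forall n (s : n.-tuple R) (x : n.+1.-tuple 'rV[R]_k),
    (forall i, tnth s i \in `[0, 1]%R) ->
    (forall i, unit_cube (tnth x i)) ->
    forecast s x \in `[0, 1]%R }.

Definition forecasts (R : realType) (k : nat) (f : forecasting_algorithm R k)
    (S : nat -> R) (x : nat -> 'rV[R]_k) (n : nat) : R :=
  forecast f [tuple S i | i < n] [tuple x i | i < n.+1].

(* Distributions on [0,1] are Borel probabilities on R carried by [0,1]; the
   values of [rlaw n] outside [0,1] are irrelevant. *)
Record randomization_method (R : realType) := RandomizationMethod {
  rlaw : nat -> R -> probability (measurableTypeR R) R ;
  rlaw_unit : forall n y, y \in `[0, 1]%R -> rlaw n y `[0, 1]%classic = 1%E ;
  rlaw_mean : forall n y, y \in `[0, 1]%R -> ('E_(rlaw n y)[idfun] = y%:E)%E }.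

Definition rvar (R : realType) (m : randomization_method R) (n : nat) (y : R) :
    \bar R :=
  ('E_(rlaw m n y)[fun z : R => ((z - y) ^+ 2)%R])%E.

Definition mutually_independent (d : measure_display) (T : measurableType d)
    (R : realType) (P : probability T R) (I : eqType)
    (X : I -> {RV P >-> measurableTypeR R}) : Prop :=
  forall (s : seq I) (B : I -> set (measurableTypeR R)),
    uniq s -> (forall i, measurable (B i)) ->
    P (\bigcap_(i in [set` s]) (X i @^-1` B i)) =
    (\prod_(i <- s) P (X i @^-1` B i))%E.

(* A realization, on some probability space, of the randomizations of the
   forecasts [p n] and of the signal coordinates [x n ord0 j]. All of them, for
   all steps and coordinates together, form a single mutually independent
   family; the index [(n, None)] stands for the forecast and [(n, Some j)] for
   the j-th signal coordinate at step n. *)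
Definition randomized_by (R : realType) (k : nat) (m : randomization_method R)
    (p : nat -> R) (x : nat -> 'rV[R]_k)
    (d : measure_display) (T : measurableType d) (P : probability T R)
    (pt : nat -> {RV P >-> measurableTypeR R})
    (xt : nat -> 'I_k -> {RV P >-> measurableTypeR R}) : Prop :=
  [/\ forall n (B : set (measurableTypeR R)), measurable B ->
        distribution P (pt n) B = rlaw m n (p n) B,
      forall n j (B : set (measurableTypeR R)), measurable B ->
        distribution P (xt n j) B = rlaw m n (x n ord0 j) B
    & mutually_independent (fun nj : nat * option 'I_k =>
        if nj.2 is Some j then xt nj.1 j else pt nj.1)].

(* Main.v *)
Require Import Defs.
From HB Require Import structures.
From mathcomp Require Import all_boot all_order all_algebra.
From mathcomp Require Import all_classical all_reals all_analysis.
From mathcomp Require Import measurable_realfun ring lra zify.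

Set Implicit Arguments.
Unset Strict Implicit.
Unset Printing Implicit Defensive.

Import Order.TTheory GRing.Theory Num.Theory.
Import numFieldNormedType.Exports.

Local Open Scope classical_set_scope.
Local Open Scope ring_scope.

(** At step [n] a number [y] of [0,1] is randomized to the two neighbouring nodes
   of the mesh of step [1/N], [N = mesh k n], with barycentric weights; the
   weight [weight y v] with which a point [y] of the cube is moved to the node
   [v] is then continuous in [y].  The forecast is chosen by the intermediate
   value theorem so that the sum over [v] of [weight (p_n, x_n) v * M_v] times
   [s - p_n] is nonpositive for every outcome [s], where [M_v] is the sum of the
   past values of [weight (p_i, x_i) v * (S_i - p_i)] over the steps of the same
   mesh.  Hence the sum of the squares [M_v ^+ 2] over all nodes of all meshes
   grows by at most 1 per step, and the expected cumulative gain, which is at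
   most the sum of the [|M_v|] plus a discretization error of [1/N] per step, is
   [o(n)] because the mesh is refined so slowly that there are only [o(n)] nodes
   up to step [n].  The centered gains are bounded and pairwise orthogonal, so
   their average tends to 0 almost surely by the second moment method along the
   squares.  The test set need not be measurable, since only its trace on the
   mesh nodes matters. *)

(** * Hat functions and piecewise linear interpolation at the integers *)

Section hat.
Context {R : realType}.
Implicit Types t y : R.

Definition hat t : R := Num.max 0 (1 - `|t|).

Lemma hat_ge0 t : 0 <= hat t.
Proof. by rewrite /hat le_max lexx. Qed.

Lemma hat_eq0 t : 1 <= `|t| -> hat t = 0.
Proof. by move=> t1; apply/max_idPl; rewrite subr_le0. Qed.

Lemma hat_continuous : continuous hat.
Proof.
move=> t; apply: (@continuous_max _ _ (fun=> 0) (fun t => 1 - `|t|)).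
  exact: cvg_cst.
by apply: cvgB; [exact: cvg_cst|exact: norm_continuous].
Qed.

(** Piecewise linear interpolation reproduces affine functions: constants give total mass 1, the
    identity gives preservation of the mean. In the induction, either [y <= N] and the new node has
    weight 0, or only the last two nodes contribute. *)
Lemma sum_hat_affine N y (a b : R) : 0 <= y <= N%:R ->
  \sum_(v < N.+1) hat (y - v%:R) * (a + b * v%:R) = a + b * y.
Proof.
elim: N => [|N IHN] /andP[y0 yN].
  have -> : y = 0 by apply/le_anti/andP.
  by rewrite big_ord1 /hat subr0 normr0 subr0 max_r// mul1r.
have [yN'|Ny] := leP y N%:R.
  rewrite big_ord_recr/= IHN ?y0// hat_eq0 ?mul0r ?addr0//.
  by rewrite ler0_norm; rewrite -natr1; lra.
rewrite 2!big_ord_recr/= big1 => [|v _].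
  move: yN; rewrite /hat -natr1 => yN.
  rewrite (@ger0_norm _ (y - N%:R)); last lra.
  rewrite (@ler0_norm _ (y - _)); last lra.
  rewrite (@max_r _ _ 0 (1 - (y - _))); last lra.
  by rewrite max_r; [ring|lra].
rewrite hat_eq0 ?mul0r//.
have : v.+1%:R <= N%:R :> R by rewrite ler_nat.
by rewrite -natr1 => vN; rewrite ger0_norm; lra.
Qed.

Lemma sum_hat N y : 0 <= y <= N%:R -> \sum_(v < N.+1) hat (y - v%:R) = 1.
Proof.
move=> /(sum_hat_affine 1 0); rewrite mul0r addr0 => yN.
by rewrite -[RHS]yN; apply: eq_bigr => v _; rewrite mul0r addr0 mulr1.
Qed.

End hat.

(** * Barycentric weights on a mesh of the cube *)

Section weight.
Context {R : realType} {C : finType}.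
Implicit Types y : C -> R.

(** A node is stored by its integer coordinates; [v] stands for the point with coordinates
    [v c / N]. *)
Definition grid (N : nat) := {ffun C -> 'I_N.+1}.

Definition weight (N : nat) y (v : grid N) : R :=
  \prod_c hat (N%:R * y c - (v c)%:R).

Lemma weight_ge0 N y (v : grid N) : 0 <= weight y v.
Proof. by apply: prodr_ge0 => c _; exact: hat_ge0. Qed.

(** Distributivity turns the sum of products into a product over [c] of one-dimensional sums, each
    equal to 1. *)
Lemma sum_weight N y : (forall c, y c \in `[0, 1]) ->
  \sum_(v : grid N) weight y v = 1.
Proof.
move=> y01; rewrite -(bigA_distr_bigA (fun c (j : 'I_N.+1) =>
  hat (N%:R * y c - j%:R))) big1// => c _.
have := y01 c; rewrite in_itv/= => /andP[yc0 yc1].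
by rewrite sum_hat// mulr_ge0//= ler_piMr.
Qed.

Lemma weight_le1 N y (v : grid N) : (forall c, y c \in `[0, 1]) ->
  weight y v <= 1.
Proof.
move=> y01; rewrite -(sum_weight N y01) (bigD1 v)//= lerDl.
by apply: sumr_ge0 => u _; exact: weight_ge0.
Qed.

Lemma weight_near N y (v : grid N) c : weight y v != 0 ->
  `|N%:R * y c - (v c)%:R| <= 1.
Proof.
apply: contraNT; rewrite -ltNge => /ltW/hat_eq0 v0.
by rewrite /weight (bigD1 c)//= v0 mul0r.
Qed.

Lemma weight_continuous N (y : R -> C -> R) (v : grid N) :
  (forall c, continuous (y^~ c)) -> continuous (fun p => weight (y p) v).
Proof.
move=> cy; apply: continuous_big => [|c _ p]; first exact: mul_continuous.
apply: (cvg_comp _ hat); last exact: hat_continuous.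
apply: cvgB; last exact: cvg_cst.
by apply: cvgM; [exact: cvg_cst|exact: cy].
Qed.

End weight.

(** If [U 0 <= 0], forecast 0 works, since no outcome lies below it; if [U 1 >= 0], forecast 1
    works, since none lies above it; otherwise [U] changes sign and a zero of [U] works. *)
Lemma defensive_choice (R : realType) (U : R -> R) : continuous U ->
  exists p, p \in `[0, 1] /\ forall s, s \in `[0, 1] -> U p * (s - p) <= 0.
Proof.
move=> cU; have [U0|U0] := leP (U 0) 0.
  exists 0; rewrite in_itv/= lexx ler01; split=> // s.
  by rewrite in_itv/= subr0 => /andP[s0 _]; rewrite mulr_le0_ge0.
have [U1|U1] := leP 0 (U 1).
  exists 1; rewrite in_itv/= lexx ler01; split=> // s.
  by rewrite in_itv/= => /andP[_ s1]; rewrite mulr_ge0_le0// subr_le0.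
have [|||p p01 Up] := @IVT R U 0 1 0 => //.
- exact: continuous_subspaceT.
- by rewrite ge_min le_max (ltW U0) (ltW U1) orbT.
- by exists p; split=> // s _; rewrite Up mul0r.
Qed.

(** * The forecasting algorithm, with [nc n] the mesh used at step [n] *)

Section algorithm.
Context {R : realType} {k : nat}.
Variable nc : nat -> nat.
Implicit Types (S ps : nat -> R) (x : nat -> 'rV[R]_k).

(** Forecast and signal form one point of a cube of dimension [k + 1], with the indexing of
    [randomized_by]: [None] for the forecast. *)
Definition point (p : R) (x : 'rV[R]_k) (c : option 'I_k) : R :=
  if c is Some j then x ord0 j else p.

Lemma point01 p (x : 'rV[R]_k) : p \in `[0, 1] -> unit_cube x ->
  forall c, point p x c \in `[0, 1].
Proof. by move=> p01 x01 [j|]//=; exact: x01. Qed.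

Definition residual S x ps N (v : grid (C := option 'I_k) N) n : R :=
  \sum_(i < n | nc i == N) weight (point (ps i) (x i)) v * (S i - ps i).

(** When forecast [p] meets outcome [s], both in [0,1], the sum of the squared residuals grows by
    [2 * drift * (s - p)] plus a term at most 1; the forecast has to control the first term. *)
Definition drift S x ps n p : R :=
  \sum_(v : grid (nc n)) weight (point p (x n)) v * residual S x ps v n.

Lemma drift_continuous S x ps n : continuous (drift S x ps n).
Proof.
apply: continuous_big => [|v _ p]; first exact: add_continuous.
apply: cvgM; last exact: cvg_cst.
apply: (weight_continuous (y := fun p => point p (x n))) => -[j|] q /=.
  exact: cvg_cst.
exact: cvg_id.
Qed.

Definition defensive S x ps n : set R :=
  [set p | p \in `[0, 1] /\
    forall s, s \in `[0, 1] -> drift S x ps n p * (s - p) <= 0].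

(* [xget] makes the choice depend on the history only through the function
   [drift], which needs no proof of continuity to be stated. *)
Definition next S x ps n : R := xget 0 (defensive S x ps n).

Lemma nextP S x ps n : defensive S x ps n (next S x ps n).
Proof.
by have [p] := defensive_choice (@drift_continuous S x ps n); exact: xgetI.
Qed.

(** Causality of the choice: only [n] outcomes, [n] forecasts and [n + 1] signals are read. *)
Lemma eq_next S S' x x' ps ps' n :
    (forall i, (i < n)%N -> S i = S' i) ->
    (forall i, (i <= n)%N -> x i = x' i) ->
    (forall i, (i < n)%N -> ps i = ps' i) ->
  next S x ps n = next S' x' ps' n.
Proof.
move=> SS' xx' pp'; rewrite /next /defensive.
suff -> : drift S x ps n = drift S' x' ps' n by [].
apply/funext => p; apply: eq_bigr => v _; rewrite xx'//; congr (_ * _).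
by apply: eq_bigr => i _; rewrite SS'// pp'// xx'// ltnW.
Qed.

(** Each forecast depends on all earlier ones, so the recursion carries their list. The default 0 of
    [nth] is never read, by [eq_next]. *)
Fixpoint history S x n : seq R :=
  if n is m.+1
  then rcons (history S x m) (next S x (nth 0 (history S x m)) m) else [::].

Definition prediction S x n : R := next S x (nth 0 (history S x n)) n.

Lemma size_history S x n : size (history S x n) = n.
Proof. by elim: n => //= n IHn; rewrite size_rcons IHn. Qed.

Lemma nth_history S x n i : (i < n)%N ->
  nth 0 (history S x n) i = prediction S x i.
Proof.
elim: n => // n IHn; rewrite ltnS leq_eqVlt /= nth_rcons size_history.
by case: eqP => [->|_ /= i_n]; [rewrite ltnn|rewrite i_n IHn].
Qed.

Lemma eq_prediction S S' x x' n :
    (forall i, (i < n)%N -> S i = S' i) ->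
    (forall i, (i <= n)%N -> x i = x' i) ->
  prediction S x n = prediction S' x' n.
Proof.
elim/ltn_ind: n => n IHn SS' xx'; apply: eq_next => // i i_n.
rewrite !nth_history//; apply: IHn => // j ji.
  by rewrite SS'// (ltn_trans ji).
by rewrite xx'// (leq_trans ji)// ltnW.
Qed.

Lemma predictionP S x n : defensive S x (prediction S x) n (prediction S x n).
Proof.
rewrite [X in defensive _ _ _ _ X](_ : _ = next S x (prediction S x) n).
  exact: nextP.
by apply: eq_next => // i i_n; rewrite nth_history.
Qed.

Lemma prediction01 S x n : prediction S x n \in `[0, 1].
Proof. by have [] := predictionP S x n. Qed.

(** The finite histories are padded with zeros to sequences; [eq_prediction] shows that the padding
    does not affect the forecast. *)
Definition defensive_forecasting : forecasting_algorithm R k :=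
  @ForecastingAlgorithm R k
    (fun n s t => prediction (nth 0 s) (nth 0 t) n)
    (fun n s t _ _ => prediction01 (nth 0 s) (nth 0 t) n).

Lemma forecastsE S x :
  forecasts defensive_forecasting S x = prediction S x.
Proof.
apply/funext => n; apply: eq_prediction => i i_n.
  by rewrite -[i]/(nat_of_ord (Ordinal i_n)) -tnth_nth tnth_mktuple.
by rewrite -[i]/(nat_of_ord (Ordinal (i_n : i < n.+1)%N)) -tnth_nth
  tnth_mktuple.
Qed.

End algorithm.

(** * Deterministic bounds on the residuals and on the expected gain *)

Section analysis.
Context {R : realType} {k : nat}.
Variables (nc : nat -> nat) (S ps : nat -> R) (x : nat -> 'rV[R]_k).
Hypothesis nc_gt0 : forall n, (0 < nc n)%N.
Hypothesis S01 : forall n, S n \in `[0, 1].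
Hypothesis x01 : forall n, unit_cube (x n).
Hypothesis psP : forall n, defensive nc S x ps n (ps n).

Local Notation grid N := (grid (C := option 'I_k) N).

Let ps01 n : ps n \in `[0, 1]. Proof. by have [] := psP n. Qed.

Let pt01 n c : point (ps n) (x n) c \in `[0, 1].
Proof. exact: point01. Qed.

Let residualS N (v : grid N) n : residual nc S x ps v n.+1 =
  residual nc S x ps v n +
  (if nc n == N then weight (point (ps n) (x n)) v * (S n - ps n) else 0).
Proof. by rewrite /residual big_mkcond big_ord_recr/= -big_mkcond. Qed.

Let dist01 (a b : R) : a \in `[0, 1] -> b \in `[0, 1] -> (a - b) ^+ 2 <= 1.
Proof.
rewrite !in_itv/= => /andP[a0 a1] /andP[b0 b1].
by rewrite -[_ ^+ 2]real_normK ?num_real ?expr_le1// ler_norml; lra.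
Qed.

(** A step changes only the residuals of the mesh in use. Its cross term is nonpositive by the
    choice of the forecast, and its quadratic term is at most the total weight 1, since weights and
    squared errors are at most 1. *)
Lemma potential_le K n :
  \sum_(N < K) \sum_(v : grid N) residual nc S x ps v n ^+ 2 <= n%:R.
Proof.
elim: n => [|n IHn].
  rewrite big1// => N _; rewrite big1// => v _.
  by rewrite /residual big_ord0 expr0n.
have step N : \sum_(v : grid N) residual nc S x ps v n.+1 ^+ 2 <=
    \sum_(v : grid N) residual nc S x ps v n ^+ 2 + (nc n == N)%:R.
  case: eqP => [<-|ncN]; last first.
    rewrite addr0 le_eqVlt; apply/orP; left; apply/eqP/eq_bigr => v _.
    by rewrite residualS; case: eqP => //; rewrite addr0.
  rewrite (eq_bigr (fun v : grid (nc n) => residual nc S x ps v n ^+ 2 +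
    (2 * (weight (point (ps n) (x n)) v * residual nc S x ps v n *
      (S n - ps n)) + weight (point (ps n) (x n)) v ^+ 2 * (S n - ps n) ^+ 2)));
    last by move=> v _; rewrite residualS eqxx; ring.
  rewrite big_split/= lerD2l big_split/= -[leRHS]add0r lerD//.
    rewrite -mulr_sumr -mulr_suml pmulr_rle0//.
    by have [_] := psP n; apply.
  rewrite -(sum_weight (nc n) (pt01 n)); apply: ler_sum => v _.
  have w0 := weight_ge0 (point (ps n) (x n)) v.
  rewrite expr2 -mulrA ler_piMr// mulr_ile1 ?sqr_ge0 ?weight_le1 ?dist01//.
apply: (le_trans (ler_sum _ (fun N _ => step (nat_of_ord N)))).
rewrite big_split/= -natr1 lerD//.
(* At most one mesh below [K] is in use at step [n]. *)
rewrite -natr_sum (_ : 1 = 1%:R :> R)// ler_nat.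
have [ncK|Knc] := ltnP (nc n) K.
  rewrite (bigD1 (Ordinal ncK))//= eqxx big1// => N.
  by rewrite -val_eqE/= eq_sym => /negbTE ->.
rewrite big1// => N _; case: eqP => // ncN.
by move: (ltn_ord N); rewrite -ncN ltnNge Knc.
Qed.

Variable I : forall N, grid N -> R.
Hypothesis I01 : forall N (v : grid N), 0 <= I v <= 1.

(** The expected gain of step [i]: node [v] is drawn with probability its weight, and the forecast
    that counts is the randomized one, [v None / nc i]. [I] stands for the trace of the test set on
    the nodes. *)
Definition mean_term i : R := \sum_(v : grid (nc i))
  weight (point (ps i) (x i)) v * (I v * (S i - (v None)%:R / (nc i)%:R)).

(** By [weight_near], a node of nonzero weight has its forecast coordinate within one mesh step of
    [ps i]; the weights average this error. *)
Let mean_term_near i : `|mean_term i - \sum_(v : grid (nc i))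
    weight (point (ps i) (x i)) v * (I v * (S i - ps i))| <= (nc i)%:R^-1.
Proof.
rewrite -sumrB (le_trans (ler_norm_sum _ _ _))//.
rewrite -[leRHS]mul1r -[X in _ <= X * _](sum_weight (nc i) (pt01 i)) mulr_suml.
apply: ler_sum => v _; set w := weight _ _.
have nc0 : 0 < (nc i)%:R :> R by rewrite ltr0n.
have -> : w * (I v * (S i - (v None)%:R / (nc i)%:R)) - w * (I v * (S i - ps i))
   = w * (I v * ((nc i)%:R * ps i - (v None)%:R)) / (nc i)%:R.
  by field; rewrite gt_eqF.
rewrite 3!normrM normfV (gtr0_norm nc0) ler_pM2r ?invr_gt0//.
have w0 : 0 <= w := weight_ge0 _ _.
rewrite (ger0_norm w0); have [->|wn0] := eqVneq w 0; first by rewrite mul0r.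
have /andP[I0 I1] := I01 v.
by rewrite ler_piMr// (ger0_norm I0) mulr_ile1// (weight_near None wn0).
Qed.

(** Up to the discretization error, the sum regroups by nodes into residuals with coefficients in
    [0,1]. Bounding each [|r|] by [r ^+ 2 / t + t] brings in the potential and the number of nodes;
    [t] stays free until the limit is taken. *)
Lemma sum_mean_term_le K n t : 0 < t -> (forall i, (i < n)%N -> (nc i < K)%N) ->
  `|\sum_(i < n) mean_term i| <=
  n%:R / t + t * (\sum_(N < K) #|{: grid N}|)%:R + \sum_(i < n) (nc i)%:R^-1.
Proof.
move=> t0 ncK; pose d i : R := \sum_(v : grid (nc i))
  weight (point (ps i) (x i)) v * (I v * (S i - ps i)).
have -> : \sum_(i < n) mean_term i =
    \sum_(i < n) d i + \sum_(i < n) (mean_term i - d i).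
  by rewrite -big_split; apply: eq_bigr => i _ /=; rewrite addrC subrK.
rewrite (le_trans (ler_normD _ _))// lerD//; last first.
  by rewrite (le_trans (ler_norm_sum _ _ _))// ler_sum// => i _;
    exact: mean_term_near.
have -> : \sum_(i < n) d i =
    \sum_(N < K) \sum_(v : grid N) I v * residual nc S x ps v n.
  (* The type of [v] depends on [i] through [nc i]; a one-term sum over [N] removes this dependence,
     so that the sums can be exchanged. *)
  transitivity (\sum_(i < n) \sum_(N < K | nc i == N) \sum_(v : grid N)
      I v * (weight (point (ps i) (x i)) v * (S i - ps i))).
    apply: eq_bigr => i _; rewrite (big_pred1 (Ordinal (ncK i (ltn_ord i)))).
      by apply: eq_bigr => v _ /=; rewrite mulrCA.
    by move=> N; rewrite /= eq_sym.
  rewrite (exchange_big_dep xpredT)//=; apply: eq_bigr => N _.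
  by rewrite exchange_big; apply: eq_bigr => v _; rewrite mulr_sumr.
rewrite (le_trans (ler_norm_sum _ _ _))//.
apply: (@le_trans _ _ (\sum_(N < K) \sum_(v : grid N)
    (residual nc S x ps v n ^+ 2 / t + t))).
  apply: ler_sum => N _; rewrite (le_trans (ler_norm_sum _ _ _))//.
  apply: ler_sum => v _; have /andP[I0 I1] := I01 v.
  rewrite normrM (ger0_norm I0) -real_normK ?num_real//.
  set r := `|_|; have r0 : 0 <= r := normr_ge0 _.
  apply: (@le_trans _ _ r); first by rewrite ler_piMl.
  (* AM-GM: [r <= r^2 / t + t] *)
  rewrite -subr_ge0 (_ : _ - r = ((r - t / 2) ^+ 2 + t ^+ 2 * (3 / 4)) / t).
    by rewrite divr_ge0 ?addr_ge0 ?sqr_ge0 ?mulr_ge0 ?sqr_ge0 ?ltW.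
  by field; rewrite gt_eqF.
under eq_bigr do rewrite big_split /=.
rewrite big_split/= lerD//.
  under eq_bigr do rewrite -mulr_suml.
  rewrite -mulr_suml.
  by rewrite ler_pM2r ?invr_gt0// potential_le.
rewrite natr_sum mulr_sumr; apply: ler_sum => N _.
by rewrite sumr_const mulr_natr.
Qed.

End analysis.

(** * A slowly refined mesh and its number of nodes *)

Section mesh.

Definition root_floor e n := \max_(j < n.+1 | (j ^ e <= n)%N) (j : nat).

Lemma root_floor_exp e n : (0 < e)%N -> (root_floor e n ^ e <= n)%N.
Proof.
move=> e0; rewrite /root_floor.
apply: (big_ind (fun m => m ^ e <= n)%N) => //; first by rewrite exp0n.
by move=> i j; case: (leqP i j).
Qed.

Lemma root_floor_ge e n j : (0 < e)%N -> (j ^ e <= n)%N ->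
  (j <= root_floor e n)%N.
Proof.
move=> e0 jn; have jn' : (j < n.+1)%N.
  rewrite ltnS (leq_trans _ jn)//; case: j {jn} => // j.
  by rewrite -{1}(expn1 j.+1) leq_pexp2l.
exact: (@leq_bigmax_cond _ (fun i : 'I_n.+1 => i ^ e <= n)%N
  (@nat_of_ord _) (Ordinal jn')).
Qed.

Lemma leq_root_floor e m n : (0 < e)%N -> (m <= n)%N ->
  (root_floor e m <= root_floor e n)%N.
Proof.
by move=> e0 mn; rewrite root_floor_ge// (leq_trans (root_floor_exp _ _)).
Qed.

Lemma cvg_root_floor e : (0 < e)%N -> root_floor e @ \oo --> \oo.
Proof.
move=> e0; apply/cvgnyPge => A; near=> n; apply: root_floor_ge => //.
by near: n; exact: nbhs_infty_ge.
Unshelve. all: by end_near. Qed.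

(** All meshes up to [N] together have of the order of [N ^ k.+2] nodes; the root of order [k.+3]
    makes this [o(n)]. The successor keeps the mesh positive. *)
Definition mesh k n := (root_floor k.+3 n).+1.

Lemma cvg_mesh (R : realType) k : (fun n => (mesh k n)%:R^-1 : R) @ \oo --> 0.
Proof.
exact: (cvg_comp (root_floor k.+3) harmonic (@cvg_root_floor k.+3 isT)
  cvg_harmonic).
Qed.

Lemma card_mesh_le k n : (0 < n)%N ->
  (mesh k n * \sum_(N < (mesh k n).+1) #|{: grid (C := option 'I_k) N}| <=
   2 * 3 ^ k.+2 * n)%N.
Proof.
move=> n0; set m := mesh k n.
have r0 : (0 < root_floor k.+3 n)%N by rewrite root_floor_ge// exp1n.
have -> : (\sum_(N < m.+1) #|{: grid (C := option 'I_k) N}| =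
           \sum_(N < m.+1) N.+1 ^ k.+1)%N.
  by apply: eq_bigr => N _; rewrite card_ffun card_option !card_ord.
(* There are [m.+1] meshes, each with at most [m.+1 ^ k.+1] nodes. *)
apply: (@leq_trans (m * (m.+1 * m.+1 ^ k.+1))).
  rewrite leq_mul2l; apply/orP; right.
  rewrite -[X in (_ <= X * _)%N]card_ord -sum_nat_const leq_sum// => N _.
  by rewrite leq_exp2r// ltn_ord.
rewrite -expnS -mulnA; set r := root_floor k.+3 n in r0 *.
(* As [m = r + 1] and [r >= 1], [m <= 2 * r] and [m.+1 <= 3 * r]. *)
apply: (@leq_trans ((2 * r) * (3 * r) ^ k.+2)).
  by rewrite leq_mul// ?leq_exp2r//= /m /mesh -/r; lia.
rewrite -mulnA leq_mul2l/= expnMn mulnCA leq_mul2l -expnS.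
by rewrite root_floor_exp ?orbT.
Qed.

End mesh.

(** After division by [n] three errors remain: [1 / t], a constant times [t] over the mesh, and the
    Cesaro mean of the inverse meshes. Fixing [t = 3 / e] makes the first [e / 3]; the other two
    then vanish in the limit. *)
Lemma mean_average_cvg (R : realType) (k : nat) (S ps : nat -> R)
    (x : nat -> 'rV[R]_k) (I : forall N, grid (C := option 'I_k) N -> R) :
  (forall n, S n \in `[0, 1]) -> (forall n, unit_cube (x n)) ->
  (forall n, defensive (mesh k) S x ps n (ps n)) ->
  (forall N (v : grid N), 0 <= I N v <= 1) ->
  (fun n => n%:R^-1 * \sum_(i < n) mean_term (mesh k) S ps x I i) @ \oo -->
    (0 : R).
Proof.
move=> S01 x01 psP I01.
pose c : R := (2 * 3 ^ k.+2)%:R.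
have bound t n : 0 < t -> (0 < n)%N ->
    `|n%:R^-1 * \sum_(i < n) mean_term (mesh k) S ps x I i| <=
    t^-1 + t * (c * (mesh k n)%:R^-1) +
    n%:R^-1 * \sum_(i < n) (mesh k i)%:R^-1.
  move=> t0 n0; have nR : 0 < n%:R :> R by rewrite ltr0n.
  rewrite normrM normfV (gtr0_norm nR) ler_pdivrMl//.
  (* The mesh is nondecreasing in the step, so [(mesh k n).+1] exceeds every mesh used before step
     [n]. *)
  have H := @sum_mean_term_le R k (mesh k) S ps x (fun _ => isT) S01 x01 psP I I01
    (mesh k n).+1 n t t0.
  apply: le_trans (H _) _ => [i i_n|].
    by rewrite ltnS ltnS leq_root_floor// ltnW.
  rewrite !mulrDr lerD// ?lerD//.
    rewrite mulrCA; apply: ler_wpM2l; first exact: ltW.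
    rewrite mulrA ler_pdivlMr ?ltr0n// mulrC [leRHS]mulrC.
    by rewrite -!natrM ler_nat (leq_trans (card_mesh_le k n0)).
  by rewrite mulVKf// gt_eqF.
have am0 : (fun n => n%:R^-1 * \sum_(i < n) (mesh k i)%:R^-1 : R) @ \oo --> 0.
  rewrite -cvg_shiftS; under eq_fun do rewrite -(big_mkord xpredT
    (fun i => (mesh k i)%:R^-1)).
  exact: (cesaro (@cvg_mesh R k)).
apply/cvgrPdist_le => e e0.
have t0 : 0 < 3 / e by rewrite divr_gt0.
have c0 : (fun n => 3 / e * (c * (mesh k n)%:R^-1)) @ \oo --> 0.
  rewrite -(mulr0 (3 / e)); apply: cvgMr; rewrite -(mulr0 c).
  by apply: cvgMr; exact: cvg_mesh.
have e30 : 0 < e / 3 by rewrite divr_gt0.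
have c1 := cvgr0_norm_le _ c0 _ e30; have am1 := cvgr0_norm_le _ am0 _ e30.
near=> n; rewrite sub0r normrN (le_trans (bound _ n t0 _))//.
  by near: n; exact: nbhs_infty_gt.
rewrite invf_div [leRHS](_ : e = e / 3 + e / 3 + e / 3); last by field.
apply: lerD; [apply: lerD => //|]; rewrite (le_trans (ler_norm _))//.
- by near: n; exact: c1.
- by near: n; exact: am1.
Unshelve. all: by end_near. Qed.

(** * A strong law of large numbers for bounded orthogonal variables *)

Section lln.

(** With [m ^ 2] the largest square below or at [n], at most [2 * m] increments separate [s n] from
    [s (m ^ 2)]; divided by [n >= m ^ 2] they contribute at most [2 * c / m]. *)
Lemma cvg_average_squares (R : realType) (s : nat -> R) c :
    (forall n, `|s n.+1 - s n| <= c) ->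
    (fun m => (m ^ 2)%:R^-1 * s (m ^ 2)%N) @ \oo --> 0 ->
  (fun n => n%:R^-1 * s n) @ \oo --> (0 : R).
Proof.
move=> sc s0; have c0 : 0 <= c by exact: le_trans (normr_ge0 _) (sc 0%N).
have lip m n : `|s (m + n)%N - s m| <= c * n%:R.
  elim: n => [|n IHn]; first by rewrite addn0 subrr normr0 mulr0.
  rewrite addnS -natr1 mulrDr mulr1.
  rewrite (_ : _ - _ = (s (m + n)%N - s m) + (s (m + n).+1 - s (m + n)%N)).
    by rewrite (le_trans (ler_normD _ _))// lerD.
  by ring.
pose b m : R := `|(m ^ 2)%:R^-1 * s (m ^ 2)%N| + 2 * c * m%:R^-1.
have bound n : (0 < n)%N -> `|n%:R^-1 * s n| <= b (root_floor 2 n).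
  move=> n0; set m := root_floor 2 n.
  have m0 : (0 < m)%N by rewrite root_floor_ge.
  have mn : (m ^ 2 <= n)%N by exact: root_floor_exp.
  have nm : (n - m ^ 2 <= 2 * m)%N.
    have : (n < m.+1 ^ 2)%N by rewrite ltnNge; apply/negP => /(@root_floor_ge 2 _ _ isT);
      rewrite ltnn.
    by rewrite leq_subLR -[m.+1]addn1 sqrnD; lia.
  have nR : 0 < n%:R :> R by rewrite ltr0n.
  have mR : 0 < m%:R :> R by rewrite ltr0n.
  have mnR : m%:R ^+ 2 <= n%:R :> R by rewrite -natrX ler_nat.
  have sn : `|s n| <= `|s (m ^ 2)%N| + c * (2 * m%:R).
    rewrite -[s n](subrK (s (m ^ 2)%N)) addrC (le_trans (ler_normD _ _))// lerD//.
    rewrite -{1}(subnKC mn) (le_trans (lip _ _))// ler_wpM2l//.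
    by rewrite -natrM ler_nat.
  rewrite /b !normrM !normfV !normr_nat.
  apply: (@le_trans _ _ ((m ^ 2)%:R^-1 * (`|s (m ^ 2)%N| + c * (2 * m%:R)))).
    by rewrite ler_pM// ?invr_ge0// lef_pV2 ?posrE// ?ltr0n ?expn_gt0 ?m0// ler_nat.
  rewrite mulrDr lerD2l natrX le_eqVlt; apply/orP; left; apply/eqP.
  by field; rewrite gt_eqF.
have b0 : b @ \oo --> 0.
  rewrite -(addr0 0); apply: cvgD; first by rewrite -(normr0 R); exact: cvg_norm.
  rewrite -(mulr0 (2 * c)); apply: cvgMr.
  by rewrite -cvg_shiftS; exact: cvg_harmonic.
have br0 : b \o root_floor 2 @ \oo --> 0.
  exact: (cvg_comp (root_floor 2) b (@cvg_root_floor 2 isT) b0).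
apply/cvgr0Pnorm_le => e e0; have br1 := cvgr0_norm_le _ br0 _ e0.
near=> n; rewrite (le_trans (bound n _))//.
  by near: n; exact: nbhs_infty_gt.
by rewrite (le_trans (ler_norm _))//; near: n; exact: br1.
Unshelve. all: by end_near. Qed.

Context d (T : measurableType d) (R : realType) (P : probability T R).
Local Open Scope ereal_scope.

Lemma bounded_integrable (f : T -> R) c : measurable_fun setT f ->
  (forall w, `|f w| <= c)%R -> P.-integrable setT (EFin \o f).
Proof.
move=> mf fc; apply: measurable_bounded_integrable => //.
  exact: (le_lt_trans (probability_le1 P measurableT) (ltry 1%R)).
exists c; split; first exact: num_real.
by move=> M cM w _ /=; rewrite (le_trans (fc w))// ltW.
Qed.

Variables (Z : nat -> T -> R) (c : R).
Hypothesis mZ : forall i, measurable_fun setT (Z i).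
Hypothesis Zc : forall i w, (`|Z i w| <= c)%R.
Hypothesis Zorth : forall i j, i != j -> \int[P]_w (Z i w * Z j w)%:E = 0.

(** A probability space has a point, and [c] bounds an absolute value there. *)
Let c0 : (0 <= c)%R.
Proof.
have [w] : exists w : T, True.
  apply: contrapT => nT; have : P setT = 0.
    rewrite (_ : setT = set0) ?measure0// -subset0 => w _.
    by apply: nT; exists w.
  by rewrite probability_setT => /eqP; rewrite onee_eq0.
by move=> _; exact: le_trans (normr_ge0 _) (Zc 0%N w).
Qed.

Let Zij_int i j : P.-integrable setT (fun w => (Z i w * Z j w)%:E).
Proof.
apply: (@bounded_integrable (fun w => Z i w * Z j w)%R (c * c)%R).
  exact: measurable_funM.
by move=> w; rewrite normrM ler_pM.
Qed.

Let measurable_partial_sum n :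
  measurable_fun setT (fun w => \sum_(i < n) Z i w)%R.
Proof. exact: measurable_sum. Qed.

(** Orthogonality kills the off-diagonal products; each of the [n] diagonal ones is at most
    [c ^+ 2]. *)
Lemma second_moment_sum_le n :
  \int[P]_w ((\sum_(i < n) Z i w) ^+ 2)%:E <= (n%:R * c ^+ 2)%:E.
Proof.
under eq_integral do rewrite expr2 mulr_suml -sumEFin.
rewrite integral_sum//; last first.
  move=> i; under eq_fun do rewrite mulr_sumr -sumEFin.
  by apply: integrable_sum => // j _; exact: Zij_int.
rewrite mulr_natl -[X in (_ *+ X)%R](card_ord n) -sumr_const -sumEFin.
apply: lee_sum => i _; under eq_integral do rewrite mulr_sumr -sumEFin.
rewrite integral_sum//.
rewrite (bigD1 i)//= big1 ?adde0 => [|j ji]; last by rewrite Zorth// eq_sym.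
apply: (@le_trans _ _ (\int[P]_w (cst (c ^+ 2)%:E) w)); last first.
  by rewrite integral_cst// [X in _ * X](probability_setT P) mule1.
apply: ge0_le_integral => //.
- by move=> w _; rewrite lee_fin -expr2 sqr_ge0.
- by apply/measurable_EFinP; exact: measurable_funM.
- by move=> w _; rewrite lee_fin -expr2 -real_normK ?num_real// lerXn2r ?nnegrE.
Qed.

(** Along the squares the second moments of the averages are summable. The series of squared
    averages is therefore almost surely finite, its terms tend to 0, and [cvg_average_squares] fills
    the gaps. *)
Lemma lln_orthogonal : {ae P, forall w,
  (fun n => n%:R^-1 * \sum_(i < n) Z i w)%R @ \oo --> (0 : R)%R}.
Proof.
pose V m w : R := ((m.+1 ^ 2)%:R^-1 * \sum_(i < m.+1 ^ 2) Z i w)%R.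
have mV m : measurable_fun setT (fun w => (V m w ^+ 2)%:E).
  by apply/measurable_EFinP; apply: measurable_funX; exact: measurable_funM.
have V0 m w : 0 <= (V m w ^+ 2)%:E by rewrite lee_fin sqr_ge0.
(* The bound [c ^+ 2 / m.+1 ^ 2] is relaxed to a telescoping one, whose sum is at most
   [2 * c ^+ 2]. *)
have intV m : \int[P]_w (V m w ^+ 2)%:E <=
    (2 * c ^+ 2 * (m.+1%:R^-1 - m.+2%:R^-1))%:E.
  pose a : R := ((m.+1 ^ 2)%:R^-1 ^+ 2)%R.
  under eq_integral do rewrite /V exprMn -/a EFinM.
  rewrite ge0_integralZl_EFin ?sqr_ge0//; last first.
  - by apply/measurable_EFinP; apply: measurable_funX.
  - by move=> w _; rewrite lee_fin sqr_ge0.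
  apply: le_trans (lee_wpmul2l _ (second_moment_sum_le _)) _.
    by rewrite lee_fin sqr_ge0.
  rewrite -EFinM lee_fin /a natrX.
  have -> : (m.+2%:R = m.+1%:R + 1 :> R)%R by rewrite natr1.
  have : (1 <= m.+1%:R :> R)%R by rewrite ler1n.
  move: (m.+1%:R : R)%R => x x1.
  have x0 : (0 < x)%R by rewrite (lt_le_trans _ x1).
  rewrite -subr_ge0 (_ : _ - _ = c ^+ 2 * (x - 1) / (x ^+ 2 * (x + 1)))%R.
    apply: divr_ge0; apply: mulr_ge0; rewrite ?sqr_ge0 ?subr_ge0//.
    by rewrite addr_ge0// ltW.
  by field; rewrite !gt_eqF ?addr_gt0.
have intsum : \int[P]_w (\sum_(m <oo) (V m w ^+ 2)%:E) < +oo.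
  rewrite integral_nneseries//; apply: (@le_lt_trans _ _ (2 * c ^+ 2)%:E); last first.
    exact: ltry.
  apply: lime_le; first by apply: is_cvg_nneseries => m _ _; exact: integral_ge0.
  apply: nearW => M; apply: (le_trans (lee_sum _ (fun m _ => intV m))).
  rewrite sumEFin lee_fin -mulr_sumr ler_piMr ?mulr_ge0 ?sqr_ge0//.
  rewrite (telescope_sumr_eq (fun m => - m.+1%:R^-1)%R)//.
    by rewrite opprK invr1 addrC lerBlDr lerDl invr_ge0.
  by move=> m _; rewrite opprK addrC.
have /integrable_ae : P.-integrable setT (fun w => \sum_(m <oo) (V m w ^+ 2)%:E).
  apply/integrableP; split.
    by apply: ge0_emeasurable_sum => // m w _ _; exact: V0.
  under eq_integral do rewrite gee0_abs ?nneseries_ge0//.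
  exact: intsum.
move=> /(_ measurableT); apply: filterS => w /(_ I) fin.
apply: (@cvg_average_squares _ _ c).
  by move=> n; rewrite big_ord_recr/= addrAC subrr add0r.
rewrite -cvg_shiftS; apply/cvgr0Pnorm_lt => e e0.
have V2 : (V m w ^+ 2)%R @[m --> \oo] --> (0 : R)%R.
  apply: cvg_series_cvg_0; apply: nnseries_is_cvg => [m|]; first exact: sqr_ge0.
  by rewrite ltey_eq fin.
have e20 : (0 < e ^+ 2)%R by rewrite exprn_gt0.
have V2e := cvgr0_norm_lt _ V2 _ e20; near=> m.
rewrite -ltr_sqr ?nnegrE ?(ltW e0)// real_normK ?num_real//.
by rewrite (le_lt_trans (ler_norm _))//; near: m; exact: V2e.
Unshelve. all: by end_near. Qed.

End lln.

(** * The law that randomizes a number to the mesh nodes *)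

Section grid_law.
Context {R : realType}.

(* Clamping makes the law a probability also for the irrelevant values of [y]. *)
Definition clamp (y : R) : R := Num.max 0 (Num.min 1 y).

Lemma clamp01 y : 0 <= clamp y <= 1.
Proof. by rewrite /clamp le_max lexx/= ge_max ler01 ge_min lexx. Qed.

Lemma clamp_id y : y \in `[0, 1] -> clamp y = y.
Proof. by rewrite in_itv/= => /andP[y0 y1]; rewrite /clamp min_r// max_r. Qed.

Definition hatn (t : R) : {nonneg R} := NngNum (hat_ge0 t).

Section def.
Variables (N : nat) (y : R).

(** Written over all [N.+1] nodes, though at most two neighbours carry mass, so that its
    coefficients are exactly the factors of [weight]. *)
Definition grid_law : set (measurableTypeR R) -> \bar R :=
  msum (fun v => mscale (hatn (N%:R * clamp y - v%:R))
    (dirac (v%:R / N%:R : measurableTypeR R))) N.+1.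

HB.instance Definition _ := Measure.on grid_law.

Let scaled : 0 <= N%:R * clamp y <= N%:R.
Proof.
by have /andP[y0 y1] := clamp01 y; rewrite mulr_ge0//= ler_piMr.
Qed.

Lemma grid_lawE B : grid_law B =
  (\sum_(v < N.+1) hat (N%:R * clamp y - v%:R) * \1_B (v%:R / N%:R))%:E.
Proof.
rewrite /grid_law /msum -sumEFin; apply: eq_bigr => v _.
by rewrite /mscale EFinM.
Qed.

Let grid_lawT : grid_law setT = 1%E.
Proof.
rewrite grid_lawE -[RHS]/(1%:E); congr EFin; rewrite -[RHS](sum_hat scaled).
by apply: eq_bigr => v _; rewrite indicT mulr1.
Qed.

HB.instance Definition _ := Measure_isProbability.Build _ _ _ grid_law grid_lawT.

Lemma ge0_integral_grid_law (f : R -> R) : measurable_fun setT f ->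
  (forall z, 0 <= f z) -> (\int[grid_law]_z (f z)%:E =
  (\sum_(v < N.+1) hat (N%:R * clamp y - v%:R) * f (v%:R / N%:R))%:E)%E.
Proof.
move=> mf f0; rewrite ge0_integral_measure_sum//; last 2 first.
- by move=> z _; rewrite lee_fin.
- exact/measurable_EFinP.
rewrite -sumEFin; apply: eq_bigr => v _.
rewrite ge0_integral_mscale//; last 2 first.
- exact/measurable_EFinP.
- by move=> z _; rewrite lee_fin.
by rewrite integral_dirac ?diracT ?mul1e//; exact/measurable_EFinP.
Qed.

End def.

Definition grid_prob N y : probability (measurableTypeR R) R := grid_law N y.

Section facts.
Variables (N : nat) (y : R).
Hypotheses (N0 : (0 < N)%N) (y01 : y \in `[0, 1]).

Let NR : 0 < N%:R :> R. Proof. by rewrite ltr0n. Qed.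

Let scaled : 0 <= N%:R * y <= N%:R.
Proof.
move: y01; rewrite in_itv/= => /andP[y0 y1].
by rewrite mulr_ge0//= ler_piMr.
Qed.

Lemma grid_prob_support (B : set R) :
  (forall v : 'I_N.+1, B (v%:R / N%:R)) -> grid_prob N y B = 1%E.
Proof.
move=> Bv; rewrite /grid_prob/= grid_lawE clamp_id// -[RHS]/(1%:E); congr EFin.
rewrite -[RHS](sum_hat scaled); apply: eq_bigr => v _.
by rewrite indicE mem_set ?mulr1.
Qed.

(** Different [v] give different points, so a single term survives. The product of these masses over
    the coordinates is [weight]. *)
Lemma grid_prob_atom (v : 'I_N.+1) :
  grid_prob N y [set v%:R / N%:R] = (hat (N%:R * y - v%:R))%:E.
Proof.
rewrite /grid_prob/= grid_lawE clamp_id// (bigD1 v)//= indicE mem_set// mulr1.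
rewrite big1 ?addr0// => u uv; rewrite indicE memNset ?mulr0//= => uvN.
move/eqP: uv; apply; apply/val_inj/eqP; rewrite -(eqr_nat R).
by apply/eqP/(divIf (lt0r_neq0 NR)).
Qed.

Lemma grid_prob_unit : grid_prob N y `[0, 1]%classic = 1%E.
Proof.
apply: grid_prob_support => v; rewrite /= in_itv/= divr_ge0//=.
by rewrite ler_pdivrMr// mul1r ler_nat -ltnS.
Qed.

Lemma grid_prob_mean : ('E_(grid_prob N y)[idfun] = y%:E)%E.
Proof.
(* The integral formula is for nonnegative functions, hence the split into positive and negative
   parts. *)
rewrite unlock integralE.
rewrite (_ : (fun z : measurableTypeR R => (idfun z)%:E)^\+%E =
  (fun z => (Num.max z 0)%:E)); last first.
  by apply/funext => z; rewrite funeposE/= -EFin_max.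
rewrite (_ : (fun z : measurableTypeR R => (idfun z)%:E)^\-%E =
  (fun z => (Num.max (- z) 0)%:E)); last first.
  by apply/funext => z; rewrite funenegE/= -EFin_max.
rewrite !ge0_integral_grid_law; last 4 first.
- apply: measurable_maxr => //.
- by move=> z; rewrite le_max lexx orbT.
- by apply: measurable_maxr => //; exact: measurable_funN.
- by move=> z; rewrite le_max lexx orbT.
rewrite clamp_id// -EFinB -sumrB; congr EFin.
transitivity (N%:R^-1 * \sum_(v < N.+1) hat (N%:R * y - v%:R) * (0 + 1 * v%:R)).
  rewrite mulr_sumr; apply: eq_bigr => v _.
  rewrite max_l ?divr_ge0// max_r ?oppr_le0 ?divr_ge0//.
  by rewrite mulr0 subr0 add0r mul1r; ring.
by rewrite sum_hat_affine// add0r mul1r mulKf// gt_eqF.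
Qed.

(** All the mass lies within [1 / N] of [y], so the variance is at most [1 / N ^ 2], hence at most
    [1 / N]. *)
Lemma grid_prob_variance :
  (0 <= 'E_(grid_prob N y)[fun z : R => ((z - y) ^+ 2)%R] <= (N%:R^-1)%:E)%E.
Proof.
rewrite expectation_ge0/= => [|z]; last exact: sqr_ge0.
rewrite unlock ge0_integral_grid_law => [||z]; last exact: sqr_ge0; last first.
  by apply: measurable_funX; exact: measurable_funB.
rewrite clamp_id// lee_fin -[leRHS]mul1r -[X in _ <= X * _](sum_hat scaled).
rewrite mulr_suml; apply: ler_sum => v _; set h := hat _.
have [/hat_eq0|/ltW near] := leP 1 `|N%:R * y - v%:R|.
  by rewrite -/h => ->; rewrite !mul0r.
apply: ler_wpM2l; first exact: hat_ge0.
rewrite (_ : _ - y = - (N%:R * y - v%:R) / N%:R); last by field; rewrite gt_eqF.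
rewrite expr_div_n sqrrN -real_normK ?num_real// ler_pdivrMr ?exprn_gt0//.
rewrite expr2 expr2 mulKf ?gt_eqF// (@le_trans _ _ 1) ?mulr_ile1//.
by rewrite ler1n.
Qed.

End facts.
End grid_law.

(** * Uncorrelated indicators and independence grouped by steps *)

Section indicators.
Context d (T : measurableType d) (R : realType) (P : probability T R).
Local Open Scope ereal_scope.

(** Independent events have indicators of zero covariance. *)
Lemma integral_centered_indicM (A B : set T) (p q : R) :
  measurable A -> measurable B -> P A = p%:E -> P B = q%:E ->
  P (A `&` B) = (p * q)%:E ->
  \int[P]_w ((\1_A w - p) * (\1_B w - q))%:E = 0.
Proof.
move=> mA mB PA PB PAB.
have mAB : measurable (A `&` B) by exact: measurableI.
have bi (E : set T) (mE : measurable E) :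
    P.-integrable setT (EFin \o (\1_E : T -> R)).
  apply: (@bounded_integrable _ _ _ _ _ 1%R); first exact: measurable_indic.
  by move=> w; rewrite indicE; case: (_ \in _); rewrite ?normr1 ?normr0.
have ci (r : R) : P.-integrable setT (EFin \o (cst r : T -> R)).
  by apply: (@bounded_integrable _ _ _ _ _ `|r|%R) => //; exact: measurable_cst.
have zi (r : R) (E : set T) (mE : measurable E) :
    P.-integrable setT (EFin \o (fun w => r * \1_E w)%R).
  apply: (@bounded_integrable _ _ _ _ _ `|r|%R).
    by apply: measurable_funM => //; exact: measurable_indic.
  by move=> w; rewrite normrM indicE ler_piMr//; case: (_ \in _);
    rewrite ?normr1 ?normr0.
have Iind (E : set T) (mE : measurable E) : \int[P]_w (\1_E w)%:E = P E.
  by rewrite integral_indic// setIT.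
have IZ (r : R) (E : set T) (mE : measurable E) :
    \int[P]_w (r * \1_E w)%:E = r%:E * P E.
  under eq_integral do rewrite EFinM.
  by rewrite integralZl//= ?Iind//; exact: bi.
transitivity (\int[P]_w
   (((\1_(A `&` B) w - q * \1_A w) - (p * \1_B w - p * q))%R)%:E).
  by apply: eq_integral => w _; rewrite indicI /=; congr EFin; ring.
under eq_integral do rewrite EFinB.
rewrite integralB_EFin//; last 2 first.
- under [X in _.-integrable _ X]eq_fun do rewrite /= EFinB.
  by apply: integrableB => //; [exact: bi|exact: zi].
- under [X in _.-integrable _ X]eq_fun do rewrite /= EFinB.
  by apply: integrableB => //; [exact: zi|exact: ci].
under eq_integral do rewrite EFinB.
rewrite integralB_EFin//; [|exact: bi|exact: zi].
under [X in _ - X]eq_integral do rewrite EFinB.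
rewrite integralB_EFin//; [|exact: zi|exact: ci].
have Icst (r : R) : \int[P]_w r%:E = r%:E.
  by rewrite integral_cst// [X in _ * X](probability_setT P) mule1.
by rewrite !IZ// Iind// Icst PA PB PAB -!EFinM -!EFinB; congr EFin; ring.
Qed.

(** Independence is applied to the list of all pairs of a step in [s] and a coordinate. *)
Lemma mutually_independent_bigcap (C : finType)
    (X : nat * C -> {RV P >-> measurableTypeR R}) (s : seq nat)
    (B : nat -> C -> set R) :
  mutually_independent X -> uniq s -> (forall i c, measurable (B i c)) ->
  P (\bigcap_(i in [set` s]) \bigcap_c (X (i, c) @^-1` B i c)) =
  \prod_(i <- s) \prod_c P (X (i, c) @^-1` B i c).
Proof.
move=> indep us mB.
have := indep [seq (i, c) | i <- s, c <- enum C] (fun ic => B ic.1 ic.2).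
rewrite allpairs_uniq ?enum_uniq//; last by move=> [? ?] [? ?].
move=> /(_ isT (fun ic => mB ic.1 ic.2)); rewrite big_allpairs/=.
rewrite (_ : \bigcap_(i in [set` [seq (i, c) | i <- s, c <- enum C]]) _ =
  \bigcap_(i in [set` s]) \bigcap_c (X (i, c) @^-1` B i c)); last first.
  apply/seteqP; split=> w H.
    move=> i si c _; apply: (H (i, c)) => /=.
    by apply/allpairsP; exists (i, c); rewrite mem_enum.
  by move=> _ /allpairsP[[i c]/= [si _ ->]]; exact: H.
by move=> ->; apply: eq_bigr => i _; rewrite big_enum.
Qed.

End indicators.

(** * Realized randomizations and almost sure calibration *)

Section realization.
Context {R : realType} {k : nat}.

Definition mesh_randomization : randomization_method R :=
  @RandomizationMethod R (fun n y => grid_prob (mesh k n) y)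
    (fun n y y01 => @grid_prob_unit R (mesh k n) y isT y01)
    (fun n y y01 => @grid_prob_mean R (mesh k n) y isT y01).

Lemma rvar_cvg (y : nat -> R) : (forall n, y n \in `[0, 1]) ->
  (fun n => rvar mesh_randomization n (y n)) @ \oo --> 0%E.
Proof.
move=> y01; apply: (@squeeze_cvge _ _ _ _ (cst 0%E) _
    (fun n => ((mesh k n)%:R^-1)%:E)).
- by apply: nearW => n; exact: grid_prob_variance.
- exact: cvg_cst.
- by apply: cvg_EFin; [exact: nearW|exact: cvg_mesh].
Qed.

Variables (S ps : nat -> R) (x : nat -> 'rV[R]_k) (SS : set (R * 'rV[R]_k)).
Hypothesis S01 : forall n, S n \in `[0, 1].
Hypothesis ps01 : forall n, ps n \in `[0, 1].
Hypothesis x01 : forall n, unit_cube (x n).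

Local Notation cgrid N := (grid (C := option 'I_k) N).

Definition node N (v : cgrid N) (c : option 'I_k) : R := (v c)%:R / N%:R.

Definition node_in N (v : cgrid N) : R :=
  \1_SS (node v None, \row_j node v (Some j)).

Definition gain i (v : cgrid (mesh k i)) : R := node_in v * (S i - node v None).
Arguments gain : clear implicits.

Lemma node_in01 N (v : cgrid N) : 0 <= node_in v <= 1.
Proof. by rewrite /node_in indicE; case: (_ \in _); rewrite ?lexx ler01. Qed.

Lemma gain_le1 i v : `|gain i v| <= 1.
Proof.
have /andP[I0 I1] := node_in01 v; rewrite normrM (ger0_norm I0) mulr_ile1//.
have := S01 i; rewrite in_itv/= => /andP[s0 s1].
have n0 : 0 <= node v None by rewrite divr_ge0.
have n1 : node v None <= 1.
  by rewrite ler_pdivrMr ?ltr0n// mul1r ler_nat -ltnS ltn_ord.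
by rewrite ler_norml; lra.
Qed.

Context d (T : measurableType d) (P : probability T R).
Variables (pt : nat -> {RV P >-> measurableTypeR R}).
Variables (xt : nat -> 'I_k -> {RV P >-> measurableTypeR R}).
Hypothesis rand : randomized_by mesh_randomization ps x pt xt.

Definition coordinate (ic : nat * option 'I_k) : {RV P >-> measurableTypeR R} :=
  if ic.2 is Some j then xt ic.1 j else pt ic.1.

Lemma coordinate_law i c (B : set (measurableTypeR R)) : measurable B ->
  P (coordinate (i, c) @^-1` B) = grid_prob (mesh k i) (point (ps i) (x i) c) B.
Proof. by case: rand => ptP xtP _ mB; case: c => [j|]; [exact: xtP|exact: ptP]. Qed.

(** The cells of a step are disjoint and cover the space almost surely; the gain is constant on
    each, which reduces it to finitely many measurable indicators. *)
Definition cell i (v : cgrid (mesh k i)) : set T :=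
  \bigcap_c (coordinate (i, c) @^-1` [set node v c]).
Arguments cell : clear implicits.

Lemma measurable_cell i v : measurable (cell i v).
Proof.
by apply: fin_bigcap_measurable.
Qed.

Let coordinate_node i (v : cgrid (mesh k i)) c :
  P (coordinate (i, c) @^-1` [set node v c]) =
  (hat ((mesh k i)%:R * point (ps i) (x i) c - (v c)%:R))%:E.
Proof. by rewrite coordinate_law// grid_prob_atom//; exact: point01. Qed.

Lemma probability_cell i v : P (cell i v) = (weight (point (ps i) (x i)) v)%:E.
Proof.
have [_ _ indep] := rand.
have := mutually_independent_bigcap (s := [:: i])
  (B := fun _ c => [set node v c]) indep isT (fun _ _ => measurable_set1 _).
rewrite set_cons1 bigcap_set1 big_seq1 => ->.
by rewrite /weight -prodEFin; apply: eq_bigr => c _; exact: coordinate_node.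
Qed.

Lemma probability_cellI i j v u : i != j ->
  P (cell i v `&` cell j u) =
  (weight (point (ps i) (x i)) v * weight (point (ps j) (x j)) u)%:E.
Proof.
move=> ij; have [_ _ indep] := rand.
(* Since [i != j], the test on [i'] prescribes [v] at step [i] and [u] at step [j]. *)
have := mutually_independent_bigcap (s := [:: i; j])
  (B := fun i' c => if i' == i then [set node v c] else [set node u c]) indep.
rewrite /= inE ij => /(_ isT); rewrite big_cons big_seq1 eqxx eq_sym (negbTE ij).
rewrite bigcap_seq big_cons big_seq1 eqxx eq_sym (negbTE ij).
move=> -> => [|i' c]; last by case: ifP => _; exact: measurable_set1.
by rewrite EFinM /weight -!prodEFin; congr *%E; apply: eq_bigr => c _;
  exact: coordinate_node.
Qed.

(** Built from cell indicators instead of [pt] and [xt], it is measurable for any test set and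
    bounded everywhere, also on the null event outside all cells. *)
Definition centered_gain i w : R := \sum_(v : cgrid (mesh k i))
  gain i v * (\1_(cell i v) w - weight (point (ps i) (x i)) v).

Local Notation mean i :=
  (mean_term (mesh k) S ps x node_in i).

Lemma centered_gainE i w :
  centered_gain i w = \sum_v gain i v * \1_(cell i v) w - mean i.
Proof.
by rewrite -sumrB; apply: eq_bigr => v _; rewrite mulrBr [in X in _ - X]mulrC.
Qed.

Lemma cell_inj i v u w : cell i v w -> cell i u w -> v = u.
Proof.
move=> vw uw; apply/ffunP => c; apply/val_inj/eqP; rewrite -(eqr_nat R).
have := vw c I; rewrite /= (uw c I) => /divIf -> //.
by rewrite pnatr_eq0.
Qed.

Lemma sum_gain_cell i v w : cell i v w ->
  \sum_u gain i u * \1_(cell i u) w = gain i v.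
Proof.
move=> vw; rewrite (bigD1 v)//= big1 => [|u uv].
  by rewrite addr0 indicE mem_set// mulr1.
by rewrite indicE memNset ?mulr0// => /(cell_inj vw) vu; rewrite vu eqxx in uv.
Qed.

Lemma centered_gain_le2 i w : `|centered_gain i w| <= 2.
Proof.
rewrite centered_gainE (le_trans (ler_normB _ _))// -[2]/(1 + 1) lerD//.
  have [[v vw]|nv] := pselect (exists v, cell i v w).
    by rewrite (sum_gain_cell vw) gain_le1.
  rewrite big1 ?normr0// => v _; rewrite indicE memNset ?mulr0// => vw.
  by apply: nv; exists v.
rewrite (le_trans (ler_norm_sum _ _ _))// -[leRHS](sum_weight (mesh k i)
  (point01 (ps01 i) (x01 i))).
apply: ler_sum => v _; rewrite normrM (ger0_norm (weight_ge0 _ _)).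
by rewrite ler_piMr ?weight_ge0//; exact: gain_le1.
Qed.

Lemma measurable_centered_gain i : measurable_fun setT (centered_gain i).
Proof.
apply: measurable_sum => v; apply: measurable_funM => //.
by apply: measurable_funB => //; apply: measurable_indic; exact: measurable_cell.
Qed.

(** The product expands into products of centered cell indicators of two different steps, which are
    uncorrelated by [probability_cellI]. *)
Lemma centered_gain_orthogonal i j : i != j ->
  (\int[P]_w (centered_gain i w * centered_gain j w)%:E = 0)%E.
Proof.
move=> ij; pose f l v w : R := \1_(cell l v) w - weight (point (ps l) (x l)) v.
have mf l v : measurable_fun setT (f l v).
  by apply: measurable_funB => //; apply: measurable_indic; exact: measurable_cell.
have f1 l v w : `|f l v w| <= 1.
  have w0 := weight_ge0 (point (ps l) (x l)) v.
  have w1 := weight_le1 v (point01 (ps01 l) (x01 l)).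
  by rewrite /f indicE ler_norml; case: (_ \in _) => /=; lra.
have ff v u : P.-integrable setT (EFin \o (fun w => f i v w * f j u w)).
  apply: (@bounded_integrable _ _ _ _ _ 1).
    by apply: measurable_funM.
  by move=> w; rewrite normrM mulr_ile1.
transitivity (\int[P]_w (\sum_v \sum_u
    (gain i v * gain j u)%:E * (f i v w * f j u w)%:E))%E.
  apply: eq_integral => w _; rewrite mulr_suml -sumEFin; apply: eq_bigr => v _.
  rewrite mulr_sumr -sumEFin; apply: eq_bigr => u _.
  by rewrite -EFinM mulrACA.
have gff v u : P.-integrable setT
    (fun w => (gain i v * gain j u)%:E * (f i v w * f j u w)%:E)%E.
  by apply: integrableZl => //; exact: ff.
rewrite integral_sum//; last by move=> v; exact: integrable_sum.
rewrite big1// => v _; rewrite integral_sum// big1// => u _.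
rewrite integralZl//; last exact: ff.
rewrite integral_centered_indicM ?mule0//; try exact: measurable_cell;
  try exact: probability_cell.
exact: probability_cellI.
Qed.

(** Each coordinate lies on a mesh node almost surely; finitely many coordinates and countably many
    steps leave a null exceptional event. *)
Lemma ae_cell : {ae P, forall w, forall i, exists v, cell i v w}.
Proof.
apply: ae_foralln => i.
pose nodes : set R :=
  [set t | exists j : 'I_(mesh k i).+1, t = j%:R / (mesh k i)%:R].
have mnodes : measurable nodes.
  rewrite (_ : nodes = \bigcup_(j : 'I_(mesh k i).+1) [set j%:R / (mesh k i)%:R]).
    by apply: fin_bigcup_measurable => // j _; exact: measurable_set1.
  by apply/seteqP; split=> [t [j ->]|t [j _ ->]]; exists j.
have : \forall w \ae P, forall c, nodes (coordinate (i, c) w).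
  apply: filter_forall => c.
  exists (~` (coordinate (i, c) @^-1` nodes)); split => //.
  - by apply: measurableC; rewrite -[X in measurable X]setTI; exact: measurable_funP.
  - rewrite probability_setC; last first.
      by rewrite -[X in measurable X]setTI; exact: measurable_funP.
    rewrite coordinate_law// grid_prob_support ?subee//.
      exact: point01.
    by move=> v; exists v.
apply: filterS => w /fin_all_exists[v vw]; exists (finfun v) => c _ /=.
by rewrite /node ffunE.
Qed.

(** Where every step falls in a cell, the gain is [centered_gain] plus its mean; the strong law
    handles the first average, [mean_average_cvg] the second. *)
Lemma calibration : (forall n, defensive (mesh k) S x ps n (ps n)) ->
  {ae P, forall w : T, (fun n : nat => n%:R^-1 *
    \sum_(i < n) \1_SS (pt i w, \row_j xt i j w) * (S i - pt i w))
    @ \oo --> (0 : R)}.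
Proof.
move=> psP; have mean0 := mean_average_cvg S01 x01 psP node_in01.
have := lln_orthogonal measurable_centered_gain centered_gain_le2
  centered_gain_orthogonal.
apply: filterS2 ae_cell => w cw Zw.
have -> : (fun n : nat => n%:R^-1 *
    \sum_(i < n) \1_SS (pt i w, \row_j xt i j w) * (S i - pt i w)) =
  (fun n => n%:R^-1 * \sum_(i < n) centered_gain i w) \+
  (fun n => n%:R^-1 * \sum_(i < n) mean i).
  apply/funext => n /=; rewrite -mulrDr -big_split/=; congr (_ * _).
  apply: eq_bigr => i _; have [v vw] := cw i.
  rewrite centered_gainE subrK (sum_gain_cell vw) /gain /node_in.
  rewrite -(vw None I : pt i w = _); congr (\1_SS (_, _) * _).
  by apply/rowP => j; rewrite !mxE; exact: (vw (Some j) I).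
rewrite -[X in _ --> X](addr0 (0:R)); exact: (cvgD Zw mean0).
Qed.

End realization.

Theorem theorem1 (R : realType) (k : nat) (k_gt0 : (0 < k)%N) :
  exists (f : forecasting_algorithm R k) (m : randomization_method R),
  forall (S : nat -> R) (x : nat -> 'rV[R]_k) (SS : set (R * 'rV[R]_k)),
    (forall n, S n \in `[0, 1]%R) ->
    (forall n, unit_cube (x n)) ->
    SS `<=` `[0, 1]%classic `*` @unit_cube R k ->
    let p := forecasts f S x in
    (forall (d : measure_display) (T : measurableType d) (P : probability T R)
            (pt : nat -> {RV P >-> measurableTypeR R})
            (xt : nat -> 'I_k -> {RV P >-> measurableTypeR R}),
       randomized_by m p x pt xt ->
       {ae P, forall w : T,
          (fun n : nat => n%:R^-1 *
             \sum_(i < n) \1_SS (pt i w, \row_j xt i j w) * (S i - pt i w))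
          @ \oo --> (0 : R)}) /\
    (fun n : nat => rvar m n (p n)) @ \oo --> 0%E /\
    (forall j : 'I_k, (fun n : nat => rvar m n (x n ord0 j)) @ \oo --> 0%E).
Proof.
exists (defensive_forecasting (mesh k)), (mesh_randomization (k := k)).
move=> S x SS S01 x01 _ p; rewrite {}/p forecastsE.
have p01 := prediction01 (mesh k) S x.
split=> [d T P pt xt rand|].
  exact: calibration S01 p01 x01 d T P pt xt rand (predictionP (mesh k) S x).
by split=> [|j]; apply: rvar_cvg => // n; exact: x01.
Qed.
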